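(* Let $\mu=(\mu_0,\ldots,\mu_{2d-1})\in\mathbb{R}^{2d}$ be such that the moment Hankel matrix $M_d(\mu)$ is non-degenerate, as well as its top-left $(d-1)\times(d-1)$ minor. Then for $t\to\pm\infty$ inside $A_\mu$ (whenever $A_\mu$ is unbounded in the corresponding direction) at most one node among $x_1(t),\ldots,x_d(t)$ can tend to infinity (in absolute value).
   Context: The moment Hankel matrix is the $d\times d$ matrix $M_d(\mu)=(\mu_{i+j-2})_{i,j=1}^d$; it depends only on $\mu_0,\ldots,\mu_{2d-2}$. When $M_d(\mu)$ is non-degenerate, for each $t\in\mathbb{R}$ let $(\sigma_1(t),\ldots,\sigma_d(t))$ be the unique solution of the linear system $$M_d(\mu)\,(\sigma_d,\sigma_{d-1},\ldots,\sigma_1)^T=-(\mu_d,\mu_{d+1},\ldots,\mu_{2d-2},t)^T$$ (that is, $t$ takes the place of the moment $\mu_{2d-1}$), and put $Q_t(z)=z^d+\sigma_1(t)z^{d-1}+\cdots+\sigma_d(t)$. Let $H_d$ be the set of monic real polynomials of degree $d$ with all roots real and distinct, and let $A_\mu=\{t\in\mathbb{R} : Q_t\in H_d\}$, a finite union of open intervals. For $t\in A_\mu$, $x_1(t)<\cdots<x_d(t)$ denote the ordered roots of $Q_t$; these are the nodes of the solution of the Prony system $\sum_{j=1}^d a_jx_j^k=\mu_k$ ($0\le k\le 2d-2$), $\sum_{j=1}^d a_jx_j^{2d-1}=t$, and they parametrize the node projection of the Prony curve $S_{2d-2}(\mu)=\{(a,x) : a\in\mathbb{R}^d,\ x_1<\cdots<x_d,\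 \sum_j a_jx_j^k=\mu_k,\ 0\le k\le 2d-2\}$. *)

(* Defs.v *)
From mathcomp Require Import all_boot all_order all_algebra.
From mathcomp Require Import all_classical all_reals all_analysis.
Set Implicit Arguments.
Unset Strict Implicit.
Unset Printing Implicit Defensive.
Import Order.TTheory GRing.Theory Num.Theory.
Import numFieldNormedType.Exports.
Local Open Scope classical_set_scope.
Local Open Scope ring_scope.

(* Indices are 0-based: the moments mu_0, ..., mu_(2d-1) are the entries mu`_k
   of a tuple, and sigma_(k+1)(t) is prony_sigma mu t k for k : 'I_d. *)

Definition hankel (R : realType) (d : nat) (mu : (2 * d).-tuple R) : 'M[R]_d :=
  \matrix_(i < d, j < d) mu`_(i + j)%N.

Definition topleft_submx (R : realType) (d : nat) (M : 'M[R]_d) : 'M[R]_d.-1 :=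
  mxsub (widen_ord (leq_pred d)) (widen_ord (leq_pred d)) M.

(* (mu_d, ..., mu_(2d-2), t)^T *)
Definition prony_rhs (R : realType) (d : nat) (mu : (2 * d).-tuple R) (t : R) :
    'cV[R]_d :=
  \col_(i < d) (if i.+1 == d then t else mu`_(d + i)%N).

(* The linear system determines (sigma_d, ..., sigma_1)^T, hence rev_ord. *)
Definition prony_sigma (R : realType) (d : nat) (mu : (2 * d).-tuple R) (t : R)
    (k : 'I_d) : R :=
  (invmx (hankel mu) *m - prony_rhs mu t) (rev_ord k) 0.

Lemma prony_sigmaP (R : realType) (d : nat) (mu : (2 * d).-tuple R) (t : R)
    (s : 'I_d -> R) :
  \det (hankel mu) != 0 ->
  hankel mu *m (\col_i s (rev_ord i)) = - prony_rhs mu t <->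
  s =1 prony_sigma mu t.
Proof.
move=> detM; have uM : hankel mu \in unitmx by rewrite unitmxE unitfE.
split=> [sE k|sE].
  by rewrite /prony_sigma -sE mulKmx // mxE rev_ordK.
have -> : \col_i s (rev_ord i) = invmx (hankel mu) *m - prony_rhs mu t.
  by apply/colP => i; rewrite mxE sE /prony_sigma rev_ordK.
by rewrite mulKVmx.
Qed.

Definition prony_poly (R : realType) (d : nat) (mu : (2 * d).-tuple R) (t : R) :
    {poly R} :=
  'X^d + \sum_(k < d) prony_sigma mu t k *: 'X^(d - k.+1).

(* Monic polynomials of degree d with all roots real and distinct. *)
Definition hyperbolic_polys (R : realType) (d : nat) : set {poly R} :=
  [set p | exists s : seq R,
     [/\ uniq s, size s = d & p = \prod_(x <- s) ('X - x%:P)]].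

Definition prony_domain (R : realType) (d : nat) (mu : (2 * d).-tuple R) :
    set R :=
  [set t | hyperbolic_polys d (prony_poly mu t)].

Definition ordered_roots (R : realType) (d : nat) (p : {poly R})
    (y : 'I_d -> R) : Prop :=
  (forall i j : 'I_d, (i < j)%N -> y i < y j) /\
  (forall z : R, root p z <-> exists i : 'I_d, y i = z).

(* Main.v *)
Require Import Defs.
From mathcomp Require Import all_boot all_order all_algebra.
From mathcomp Require Import all_classical all_reals all_analysis.
From mathcomp Require Import ring.
Set Implicit Arguments.
Unset Strict Implicit.
Unset Printing Implicit Defensive.
Import Order.TTheory GRing.Theory Num.Theory.
Import numFieldNormedType.Exports.
Local Open Scope classical_set_scope.
Local Open Scope ring_scope.

(** Since the right-hand side of the linear system is affine in [t], so are the
    coefficients [sigma_k(t)], hence [Q_t = P + t N] with [P] and [N]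
    independent of [t].  By Cramer's rule the coefficient of [z^(d-1)] in [N]
    is, up to sign, the quotient of the top-left minor by the determinant of
    the Hankel matrix, so [N] has degree exactly [d - 1].

    In the variable [u = 1/z], [Q_t(z) = 0] reads [A(u) + t B(u) = 0], where
    [A] and [B] are polynomials, [B(0) = 0] and [B'(0) != 0].  If two distinct
    nodes tended to infinity along the same filter, their inverses [u] and [v]
    would tend to [0] and satisfy [B(u) = - t^-1 A(u)], [B(v) = - t^-1 A(v)].
    Subtracting and dividing by [u - v] relates the divided differences of [A]
    and [B]; these tend to [A'(0)] and [B'(0)], while [t^-1] tends to [0], so
    [B'(0) = 0], a contradiction.  The divided differences are handled in
    [divided_difference], the limit argument in [pencil_roots_cvg0], and the
    degree of [N] in [prony_pencil1_neq0]. *)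

(** For a polynomial [p], the quotient [(p(u) - p(v)) / (u - v)] extends to a
    function whose limit is [p'(0)], the coefficient of degree one, as [u] and
    [v] tend to [0] independently of each other. *)
Lemma divided_difference (R : realType) (p : {poly R}) :
  exists2 g : R -> R -> R,
    forall u v, p.[u] - p.[v] = (u - v) * g u v &
    forall (T : Type) (F : set_system T) (u v : T -> R), Filter F ->
      u t @[t --> F] --> (0 : R) -> v t @[t --> F] --> (0 : R) ->
      g (u t) (v t) @[t --> F] --> p`_1.
Proof.
elim/poly_ind: p => [|p c [g gE g_cvg]].
  exists (fun _ _ => 0) => [u v|T F u v FF _ _]; first by rewrite !horner0; ring.
  by rewrite coef0; exact: cvg_cst.
(* p(u) u - p(v) v = (u - v) p(u) + v (p(u) - p(v)) *)
exists (fun u v => p.[u] + v * g u v) => [u v|T F u v FF u0 v0].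
  rewrite !hornerMXaddC.
  have -> : p.[u] * u + c - (p.[v] * v + c) =
      (u - v) * p.[u] + v * (p.[u] - p.[v]) by ring.
  by rewrite gE; ring.
rewrite coefD coefMX coefC /= addr0 -horner_coef0 -[_.[0]]addr0.
rewrite -[X in _ + X](mul0r p`_1).
apply: cvgD; last by apply: cvgM => //; exact: g_cvg.
have cp : {for 0, continuous (horner p)} by exact: continuous_horner.
exact: (continuous_cvg FF cp u0).
Qed.

(** If the pencil [A + t B] has two distinct roots that both tend to [0] while
    [t] tends to infinity, then [0] is a critical point of [B]. *)
Lemma pencil_roots_cvg0 (R : realType) (A B : {poly R}) (F : set_system R)
    (u v : R -> R) : ProperFilter F ->
  t^-1 @[t --> F] --> (0 : R) ->
  u t @[t --> F] --> (0 : R) -> v t @[t --> F] --> (0 : R) ->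
  (\forall t \near F, [/\ t != 0, u t != v t, A.[u t] + t * B.[u t] = 0 &
                          A.[v t] + t * B.[v t] = 0]) ->
  B`_1 = 0.
Proof.
move=> FF t0 u0 v0 roots.
have [gA gAE gA_cvg] := divided_difference A.
have [gB gBE gB_cvg] := divided_difference B.
have cB := gB_cvg _ F u v (@filter_filter _ F FF) u0 v0.
have cA : - (t^-1 * gA (u t) (v t)) @[t --> F] --> (0 : R).
  rewrite -[X in _ --> X]oppr0 -[X in _ --> - X](mul0r A`_1).
  by apply: cvgN; apply: cvgM => //; exact: gA_cvg.
suff e : \forall t \near F, gB (u t) (v t) = - (t^-1 * gA (u t) (v t)).
  have cB0 : gB (u t) (v t) @[t --> F] --> (0 : R).
    apply: cvg_trans cA; apply: near_eq_cvg.
    by apply: filterS e => t ->.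
  exact: (cvg_unique (@Rhausdorff R) cB cB0).
apply: filterS roots => t [tn0 uv ru rv].
have uvn0 : u t - v t != 0 by rewrite subr_eq0.
(* Multiplied by t (u - v), the claim is t (B(u) - B(v)) = - (A(u) - A(v)). *)
apply: (mulfI uvn0); apply: (mulfI tn0).
have -> : t * ((u t - v t) * - (t^-1 * gA (u t) (v t))) =
    - ((u t - v t) * gA (u t) (v t)) * (t / t) by ring.
rewrite divff // mulr1 -gAE -gBE.
have /eqP := ru; rewrite addr_eq0 => /eqP ->.
by have /eqP := rv; rewrite addr_eq0 => /eqP ->; ring.
Qed.

(** The slope of the affine function [t |-> sigma_(k+1)(t)]. *)
Definition prony_slope (R : realType) (d : nat) (mu : (2 * d).-tuple R)
    (k : 'I_d) : R :=
  prony_sigma mu 1 k - prony_sigma mu 0 k.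

Lemma prony_sigma_affine (R : realType) (d : nat) (mu : (2 * d).-tuple R)
    (t : R) (k : 'I_d) :
  prony_sigma mu t k = prony_sigma mu 0 k + t * prony_slope mu k.
Proof.
rewrite /prony_slope /prony_sigma.
have -> : prony_rhs mu t =
    prony_rhs mu 0 + t *: (prony_rhs mu 1 - prony_rhs mu 0).
  by apply/matrixP => i j; rewrite !mxE; case: eqP => _; ring.
have -> : - prony_rhs mu 1 =
    - prony_rhs mu 0 - (prony_rhs mu 1 - prony_rhs mu 0).
  by rewrite opprB addKr.
by rewrite opprD !mulmxDr -scalerN -scalemxAr !mxE; ring.
Qed.

(** The polynomials [A] and [B] such that [u^d Q_t(1/u) = A(u) + t B(u)] for
    [u != 0]: reversing the coefficients puts [sigma_(k+1)], stored at index
    [k], in front of [u^(k+1)].  First [A], which also carries the leading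
    coefficient of [Q_t] as its constant term. *)
Definition prony_pencil0 (R : realType) (d : nat) (mu : (2 * d).-tuple R) :
    {poly R} :=
  1 + \sum_(k < d) prony_sigma mu 0 k *: 'X^(k.+1).

(** The polynomial [B], made of the slopes; it has no constant term. *)
Definition prony_pencil1 (R : realType) (d : nat) (mu : (2 * d).-tuple R) :
    {poly R} :=
  \sum_(k < d) prony_slope mu k *: 'X^(k.+1).

Lemma prony_pencilE (R : realType) (d : nat) (mu : (2 * d).-tuple R) (t x : R) :
  x != 0 ->
  (prony_pencil0 mu).[x^-1] + t * (prony_pencil1 mu).[x^-1] =
  x^-1 ^+ d * (prony_poly mu t).[x].
Proof.
move=> xn0; rewrite /prony_pencil0 /prony_pencil1 /prony_poly !hornerE.
rewrite !horner_sum mulrDr -exprMn mulVf // expr1n -addrA; congr (_ + _).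
rewrite !mulr_sumr -big_split /=; apply: eq_bigr => k _.
rewrite !hornerZ !hornerXn (prony_sigma_affine mu t).
have -> : x^-1 ^+ k.+1 = x^-1 ^+ d * x ^+ (d - k.+1).
  rewrite -[in X in _ ^+ X * _](subnK (ltn_ord k)) exprD mulrAC -exprMn.
  by rewrite mulVf // expr1n mul1r.
by ring.
Qed.

(** The coefficient of degree one of [B] is, up to sign, the bottom right entry
    of the inverse of the Hankel matrix, computed by Cramer's rule. *)
Lemma prony_pencil1_neq0 (R : realType) (d : nat) (d_gt0 : (0 < d)%N)
    (mu : (2 * d).-tuple R) :
  \det (hankel mu) != 0 -> \det (topleft_submx (hankel mu)) != 0 ->
  (prony_pencil1 mu)`_1 != 0.
Proof.
case: d d_gt0 mu => // d _ mu detM detm.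
rewrite /prony_pencil1 coef_sum (bigD1 ord0) //= big1 ?addr0; last first.
  move=> i; rewrite -val_eqE /= => /negPf i0.
  by rewrite coefZ coefXn eqSS eq_sym i0 mulr0.
rewrite coefZ coefXn mulr1 /prony_slope /prony_sigma.
(* Only the last entry of the right-hand side depends on t, and rev_ord sends
   sigma_1 to the last unknown: the slope is minus a corner entry of Mi. *)
set Mi := invmx _; set r := rev_ord ord0.
have rE : r = ord_max by apply/val_inj; rewrite /= subn1.
have -> : (Mi *m - prony_rhs mu 1) r 0 - (Mi *m - prony_rhs mu 0) r 0 =
    - Mi ord_max ord_max.
  have -> : - prony_rhs mu 1 = - prony_rhs mu 0 - delta_mx ord_max 0.
    apply/colP => i; rewrite !mxE -val_eqE /= eqSS andbT.
    by case: eqP => _ /=; ring.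
  rewrite mulmxBr 2!mxE addrAC subrr add0r rE -colE.
  by rewrite !mxE.
rewrite oppr_eq0 /Mi /invmx unitmxE unitfE detM !mxE /cofactor.
rewrite mulf_neq0 ?invr_eq0 // mulf_neq0 ?signr_eq0 //.
(* That entry is a signed cofactor over the determinant; for d = 1 the minor is
   the determinant of an empty matrix. *)
suff -> : row' ord_max (col' ord_max (hankel mu)) = topleft_submx (hankel mu).
  by [].
by apply/matrixP => i j; rewrite !mxE /= /bump !(leqNgt d) !ltn_ord.
Qed.

Lemma cvg_invr_norm (R : realType) (T : Type) (F : set_system T) (f : T -> R) :
  Filter F -> `|f t| @[t --> F] --> +oo ->
  (\forall t \near F, f t != 0) /\ (f t)^-1 @[t --> F] --> (0 : R).
Proof.
move=> FF f_oo; have f_gt0 : \forall t \near F, 0 < `|f t| by exact: cvgry_gt.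
split; first by apply: filterS f_gt0 => t; rewrite normr_gt0.
apply: norm_cvg0; under eq_fun do rewrite normfV.
exact/(gtr0_cvgV0 f_gt0).
Qed.

(** Both directions follow from this statement about an arbitrary filter along
    which [t] stays in [A_mu] and [|t|] tends to infinity. *)
Lemma prony_nodes_eq (R : realType) (d : nat) (d_gt0 : (0 < d)%N)
    (mu : (2 * d).-tuple R) (x : R -> 'I_d -> R) (F : set_system R)
    (i j : 'I_d) : ProperFilter F ->
  \det (hankel mu) != 0 -> \det (topleft_submx (hankel mu)) != 0 ->
  (forall t, prony_domain mu t -> ordered_roots (prony_poly mu t) (x t)) ->
  F (prony_domain mu) -> `|t| @[t --> F] --> +oo ->
  `|x t i| @[t --> F] --> +oo -> `|x t j| @[t --> F] --> +oo -> i = j.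
Proof.
move=> FF detM detm xP FA t_oo xi_oo xj_oo; apply/eqP/negPn/negP => ij.
have [tn0 t0] := cvg_invr_norm _ t_oo.
have [in0 i0] := cvg_invr_norm _ xi_oo.
have [jn0 j0] := cvg_invr_norm _ xj_oo.
have /eqP := prony_pencil1_neq0 d_gt0 detM detm; apply.
apply: (pencil_roots_cvg0 (A := prony_pencil0 mu) FF t0 i0 j0).
near=> t.
have [x_lt x_root] : ordered_roots (prony_poly mu t) (x t).
  by apply: xP; near: t.
have xin0 : x t i != 0 by near: t.
have xjn0 : x t j != 0 by near: t.
have root_x k : (prony_poly mu t).[x t k] = 0.
  by apply/eqP; apply/x_root; exists k.
split; first by near: t.
- rewrite (inj_eq invr_inj); move: ij; rewrite -val_eqE neq_ltn.
  by rewrite neq_lt => /orP[] /x_lt ->; rewrite ?orbT.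
- by rewrite prony_pencilE // root_x mulr0.
- by rewrite prony_pencilE // root_x mulr0.
Unshelve. all: by end_near.
Qed.

Theorem theorem2p5 (R : realType) (d : nat) (d_gt0 : (0 < d)%N)
    (mu : (2 * d).-tuple R)
    (det_hankel : \det (hankel mu) != 0)
    (det_minor : \det (topleft_submx (hankel mu)) != 0)
    (x : R -> 'I_d -> R)
    (x_nodes : forall t : R, prony_domain mu t ->
       ordered_roots (prony_poly mu t) (x t)) :
  (~ has_ubound (prony_domain mu) ->
     forall i j : 'I_d,
       `|x t i| @[t --> within (prony_domain mu) +oo] --> +oo ->
       `|x t j| @[t --> within (prony_domain mu) +oo] --> +oo ->
       i = j) /\
  (~ has_lbound (prony_domain mu) ->
     forall i j : 'I_d,
       `|x t i| @[t --> within (prony_domain mu) -oo] --> +oo ->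
       `|x t j| @[t --> within (prony_domain mu) -oo] --> +oo ->
       i = j).
Proof.
split=> [/has_ubPn unbounded | /has_lbPn unbounded] i j.
- have FF : ProperFilter (within (prony_domain mu) +oo).
    (* The filter is proper exactly because A_mu is unbounded. *)
    apply: Build_ProperFilter => -[M [_ MA]].
    by have [t At /MA] := unbounded M; exact.
  apply: (prony_nodes_eq d_gt0 FF det_hankel det_minor x_nodes).
    exact: withinT.
  apply/cvgryPgt => A; rewrite near_withinE.
  apply: filterS (nbhs_pinfty_gt (num_real A)) => t At _.
  exact: lt_le_trans At (ler_norm _).
- have FF : ProperFilter (within (prony_domain mu) -oo).
    apply: Build_ProperFilter => -[M [_ MA]].
    by have [t At /MA] := unbounded M; exact.
  apply: (prony_nodes_eq d_gt0 FF det_hankel det_minor x_nodes).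
    exact: withinT.
  apply/cvgryPgt => A; rewrite near_withinE.
  apply: filterS (nbhs_ninfty_lt (num_real (- A))) => t tA _.
  by rewrite -normrN; apply: lt_le_trans (ler_norm _); rewrite ltrNr.
Qed.
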